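(* Let $\mathcal{C}$ be the Cantor space and let $A\leq F\leq\mathrm{Homeo}(\mathcal{C})$ be nested groups such that $A$ is vigorous and simple, and $F$ is locally closed. Then any intermediate group $A\leq H\leq F$ is C*-simple.
   Context: A subgroup $\Gamma\leq\mathrm{Homeo}(\mathcal{C})$ is vigorous if whenever $X,Y_1,Y_2\subseteq\mathcal{C}$ are compact open with $Y_1,Y_2\subseteq X$, $Y_1\neq X$ and $Y_2\neq\emptyset$, there is $g\in\Gamma$ that is the identity on $\mathcal{C}\setminus X$ and satisfies $g(Y_1)\subseteq Y_2$. A homeomorphism $\phi$ of $\mathcal{C}$ is locally in $\Gamma$ if every $x\in\mathcal{C}$ has a neighbourhood $U$ and an element $g\in\Gamma$ with $\phi|_U=g|_U$; $\Gamma$ is locally closed if every homeomorphism of $\mathcal{C}$ that is locally in $\Gamma$ belongs to $\Gamma$. A discrete group $H$ is C*-simple if its reduced group C*-algebra $C^*_r(H)$ is simple. *)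

(* Defs.v *)
From HB Require Import structures.
From mathcomp Require Import all_boot all_order all_algebra.
From mathcomp Require Import complex ring lra.
From mathcomp Require Import all_classical all_reals all_analysis.
Set Implicit Arguments.
Unset Strict Implicit.
Unset Printing Implicit Defensive.
Import Order.TTheory GRing.Theory Num.Theory.
Local Open Scope classical_set_scope.
Local Open Scope ring_scope.

Definition homeomorphism (T : topologicalType) (f : T -> T) : Prop :=
  continuous f /\ exists g : T -> T, [/\ continuous g, cancel f g & cancel g f].

Record homeo (T : topologicalType) := Homeo {
  homeo_fun :> T -> T;
  _ : `[< homeomorphism homeo_fun >] }.

HB.instance Definition _ (T : topologicalType) :=
  [isSub for @homeo_fun T].
HB.instance Definition _ (T : topologicalType) := [Choice of homeo T by <:].

Section homeo_group.
Variable T : topologicalType.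
Implicit Types f g h : homeo T.

Lemma homeoP f : homeomorphism f.
Proof. by case: f => f /= /asboolP. Qed.

Lemma homeo_ext f g : f =1 g -> f = g.
Proof. by move=> fg; apply/val_inj/funext. Qed.

Lemma homeo_one_subproof : `[< homeomorphism (@idfun T) >].
Proof.
apply/asboolP; split; first by move=> x; exact: cvg_id.
by exists idfun; split=> // x; exact: cvg_id.
Qed.

Definition homeo_one : homeo T := Homeo homeo_one_subproof.

Lemma homeo_mul_subproof f g : `[< homeomorphism (f \o g) >].
Proof.
have [cf [f' [cf' fK f'K]]] := homeoP f.
have [cg [g' [cg' gK g'K]]] := homeoP g.
apply/asboolP; split; first by move=> x; apply: continuous_comp; [exact: cg | exact: cf].
exists (g' \o f'); split; first by move=> x; apply: continuous_comp; [exact: cf' | exact: cg'].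
- exact: can_comp.
- exact: can_comp.
Qed.

Definition homeo_mul f g : homeo T := Homeo (homeo_mul_subproof f g).

Definition homeo_inv_fun f : T -> T := sval (cid (homeoP f).2).

Lemma homeo_inv_subproof f : `[< homeomorphism (homeo_inv_fun f) >].
Proof.
rewrite /homeo_inv_fun; case: cid => g /= [cg fK gK].
by apply/asboolP; split=> //; exists f; split=> //; exact: (homeoP f).1.
Qed.

Definition homeo_inv f : homeo T := Homeo (homeo_inv_subproof f).

Lemma homeo_mulA : associative homeo_mul.
Proof. by move=> f g h; exact: homeo_ext. Qed.
Lemma homeo_mul1 : left_id homeo_one homeo_mul.
Proof. by move=> f; exact: homeo_ext. Qed.
Lemma homeo_mulr1 : right_id homeo_one homeo_mul.
Proof. by move=> f; exact: homeo_ext. Qed.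
Lemma homeo_mulV : left_inverse homeo_one homeo_inv homeo_mul.
Proof.
move=> f; apply: homeo_ext => x /=.
by rewrite /homeo_inv_fun; case: cid => g /= [].
Qed.
Lemma homeo_mulrV : right_inverse homeo_one homeo_inv homeo_mul.
Proof.
move=> f; apply: homeo_ext => x /=.
by rewrite /homeo_inv_fun; case: cid => g /= [].
Qed.

HB.instance Definition _ := isGroup.Build (homeo T)
  homeo_mulA homeo_mul1 homeo_mulr1 homeo_mulV homeo_mulrV.
End homeo_group.

(* A subgroup of [G] is an [S : groupClosed G]; this is [S] as a group on its own *)
Section subgroup_type.
Variables (G : groupType) (S : groupClosed G).

Record subgroup := Subgroup { subgroup_val :> G; _ : subgroup_val \in S }.

HB.instance Definition _ := [isSub for subgroup_val].
HB.instance Definition _ := [Choice of subgroup by <:].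

Lemma subgroup_closed : group_closed S.
Proof.
by split=> [|x y xS yS]; [exact: gpred1 | exact: gpredM xS (gpredVr _ yS)].
Qed.

HB.instance Definition _ :=
  SubChoice_isSubGroup.Build G (S : {pred G}) subgroup subgroup_closed.
End subgroup_type.

Definition simple_group (G : groupType) : Prop :=
  (exists x : G, x <> 1%g) /\
  forall N : groupClosed G,
    (forall x y : G, x \in N -> (x ^ y)%g \in N) ->
    (forall x : G, x \in N -> x = 1%g) \/ (forall x : G, x \in N).

Section groups_of_homeomorphisms.
Variable T : topologicalType.

Definition vigorous (Gamma : {pred homeo T}) : Prop :=
  forall X Y1 Y2 : set T,
    compact X -> open X -> compact Y1 -> open Y1 -> compact Y2 -> open Y2 ->
    Y1 `<=` X -> Y2 `<=` X -> Y1 <> X -> Y2 <> set0 ->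
    exists g : homeo T,
      [/\ g \in Gamma, (forall x, ~ X x -> g x = x) & g @` Y1 `<=` Y2].

Definition locally_in (Gamma : {pred homeo T}) (phi : homeo T) : Prop :=
  forall x : T, exists (U : set T) (g : homeo T),
    [/\ nbhs x U, g \in Gamma & {in U, phi =1 g}].

Definition locally_closed (Gamma : {pred homeo T}) : Prop :=
  forall phi : homeo T, locally_in Gamma phi -> phi \in Gamma.

End groups_of_homeomorphisms.

Section l2.
Variables (R : realType) (G : groupType).
Implicit Types v w : G -> R[i]^o.

Definition sqnorm v : \bar R :=
  \esum_(g in [set: G]) ((Normc.normc (v g)) ^+ 2)%:E.

Definition sq_summable : {pred G -> R[i]^o} :=
  fun v => `[< (sqnorm v < +oo)%E >].

Lemma sq_summable_submod : submod_closed sq_summable.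
Proof.
split=> [|a v w /asboolP sv /asboolP sw].
  apply/asboolP; rewrite /sqnorm esum1// => g _.
  by rewrite [Normc.normc _](Normc.normc0 R) expr0n.
pose u g : R := 2 * Normc.normc a ^+ 2 * Normc.normc (v g) ^+ 2.
pose u' g : R := 2 * Normc.normc (w g) ^+ 2.
have esumM c (f : G -> R) : 0 <= c -> (forall g, 0 <= f g) ->
    (\esum_(g in [set: G]) (f g)%:E < +oo)%E ->
    (\esum_(g in [set: G]) (c * f g)%:E < +oo)%E.
  move=> c0 f0 sf; apply: (@le_lt_trans _ _
      (c%:E * \esum_(g in [set: G]) (f g)%:E)%E); last first.
    by rewrite lte_mul_pinfty// lee_fin.
  apply: ge_ereal_sup => _ [X [finX XI]] <-.
  under eq_fsbigr do rewrite EFinM.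
  rewrite -ge0_mule_fsumr; last by move=> g; rewrite lee_fin.
  by apply: lee_wpmul2l; rewrite ?lee_fin// esum_ge//; exists X.
apply/asboolP; apply: (@le_lt_trans _ _
    (\esum_(g in [set: G]) ((u g)%:E + (u' g)%:E))%E).
  apply: le_esum => g _; rewrite -EFinD lee_fin.
  have h := le_normcD (a * v g : Rcomplex R) (w g).
  have : Normc.normc (a * v g + w g) ^+ 2
      <= (Normc.normc (a * v g) + Normc.normc (w g)) ^+ 2.
    by rewrite ler_sqr ?nnegrE// ?addr_ge0// ?(@normr_ge0 R (Rcomplex R)).
  move/le_trans; apply.
  rewrite /u /u' -mulrA -exprMn -Normc.normcM.
  move: (Normc.normc _) (Normc.normc _) => x y.
  by rewrite -subr_ge0 (_ : _ - _ = (x - y) ^+ 2) ?sqr_ge0//; ring.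
rewrite esumD; last 2 first.
- by move=> g _; rewrite lee_fin; apply: mulr_ge0 (sqr_ge0 _); apply: mulr_ge0 (sqr_ge0 _).
- by move=> g _; rewrite lee_fin; apply: mulr_ge0 (sqr_ge0 _).
apply: lte_add_pinfty.
- by apply: (esumM _ (fun g => Normc.normc (v g) ^+ 2)) => // [|g];
    [apply: mulr_ge0 (sqr_ge0 _) | exact: sqr_ge0].
- by apply: (esumM _ (fun g => Normc.normc (w g) ^+ 2)) => // g; rewrite sqr_ge0.
Qed.

HB.instance Definition _ :=
  GRing.isSubmodClosed.Build R[i] (G -> R[i]^o) sq_summable sq_summable_submod.

Record l2 := L2 { l2_fun :> G -> R[i]^o; _ : l2_fun \in sq_summable }.

HB.instance Definition _ := [isSub for l2_fun].
HB.instance Definition _ := [Choice of l2 by <:].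
HB.instance Definition _ := [SubChoice_isSubLmodule of l2 by <:].

Definition l2norm (v : l2) : R := Num.sqrt (fine (sqnorm v)).

Lemma lreg_subproof (g : G) (v : l2) :
  (fun h => v (g^-1 * h)%g) \in sq_summable.
Proof.
case: v => v /= /asboolP sv; apply/asboolP; move: sv; rewrite /sqnorm.
rewrite (reindex_esum setT setT (fun h => g^-1 * h)%g)//.
split=> //; first by move=> x y _ _ /mulgI.
by move=> y _; exists (g * y)%g => //; rewrite mulKg.
Qed.

Definition lreg (g : G) (v : l2) : l2 := L2 (lreg_subproof g v).

End l2.

Section operators.
Variables (R : realType) (G : groupType).
Local Notation l2 := (l2 R G).

Definition bounded_op : set (l2 -> l2) :=
  [set T : l2 -> l2 | linear T /\ exists M : R, forall v : l2, l2norm (T v) <= M * l2norm v].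

(* only meaningful on [bounded_op], where the supremum is finite *)
Definition opnorm (T : l2 -> l2) : R :=
  sup [set l2norm (T v) | v in [set v : l2 | l2norm v <= 1]].

Definition op_closure (A : set (l2 -> l2)) : set (l2 -> l2) :=
  [set T : l2 -> l2 | bounded_op T /\
    forall e : R, 0 < e -> exists2 S, A S & opnorm (T - S) < e].

Definition lreg_span : set (l2 -> l2) :=
  [set S : l2 -> l2 | exists s : seq (R[i] * G), S = \sum_(p <- s) p.1 *: (lreg p.2 : l2 -> l2)].

Definition reduced_Cstar : set (l2 -> l2) := op_closure lreg_span.

Definition closed_ideal (A I : set (l2 -> l2)) : Prop :=
  [/\ I `<=` A,
      I 0,
      (forall (a : R[i]) S T, I S -> I T -> I (a *: S + T)),
      (forall S T, A S -> I T -> I (S \o T) /\ I (T \o S)) &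
      op_closure I `<=` I].

Definition simple_Cstar (A : set (l2 -> l2)) : Prop :=
  A <> [set 0] /\ forall I, closed_ideal A I -> I = [set 0] \/ I = A.

Definition Cstar_simple : Prop := simple_Cstar reduced_Cstar.

End operators.

(* Main.v *)
(* Powers' averaging method. If [t] displaces a clopen set [V] (that is, [V] and
   [t V] are disjoint) and [h_1, ..., h_m] are supported in [V], then
   [h_i t h_i^-1 = h_i (t h_i^-1 t^-1) t], where [t h_i^-1 t^-1] is the identity
   on [V]. Vigour gives such [h_i] in [A] throwing [V \ B_i] into [B_i] for
   disjoint clopen [B_i] in [V], and a ping-pong estimate bounds the average of
   the [lambda (h_i t h_i^-1)] by [2 / sqrt m]. An element that is the identity on
   [V] commutes with the [h_i], so its average is unchanged; as finitely many
   elements can each be made to fix or displace a common smaller [V], and averages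
   are contractions, finitely many nontrivial elements can be averaged away one
   after the other. A nonzero closed ideal contains an operator of trace 1, whose
   averages approach the identity. *)
Require Import Defs.
From mathcomp Require Import all_boot all_order all_algebra.
From mathcomp Require Import all_classical all_reals all_analysis.
From mathcomp Require Import complex ring lra.
Set Implicit Arguments.
Unset Strict Implicit.
Unset Printing Implicit Defensive.
Import Order.TTheory GRing.Theory Num.Theory.
Local Open Scope classical_set_scope.
Local Open Scope ring_scope.

(** * Cauchy-Schwarz for finite real sums and two consequences of expanding squares *)

Section real_inequalities.
Variable R : realType.

Lemma cauchy_schwarz_seq (I : Type) (r : seq I) (a b : I -> R) :
  (\sum_(i <- r) a i * b i) ^+ 2 <=
  (\sum_(i <- r) a i ^+ 2) * (\sum_(i <- r) b i ^+ 2).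
Proof.
elim: r => [|i r IH]; first by rewrite !big_nil expr0n mul0r.
rewrite !big_cons.
have A0 : 0 <= \sum_(j <- r) a j ^+ 2 by apply: sumr_ge0 => *; exact: sqr_ge0.
have B0 : 0 <= \sum_(j <- r) b j ^+ 2 by apply: sumr_ge0 => *; exact: sqr_ge0.
move: (\sum_(j <- r) a j * b j) (\sum_(j <- r) a j ^+ 2) (\sum_(j <- r) b j ^+ 2) IH A0 B0
  => S A B.
move: (a i) (b i) => x y IH A0 B0.
(* Beyond the induction hypothesis only this cross term remains. It is compared after squaring, by
   [S ^+ 2 <= A * B] and then the arithmetic-geometric mean inequality. *)
suff : 2 * S * (x * y) <= A * y ^+ 2 + x ^+ 2 * B.
  move=> h.
  rewrite -subr_ge0 (_ : _ - _ = (A * B - S ^+ 2) +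
    (A * y ^+ 2 + x ^+ 2 * B - 2 * S * (x * y))); last by ring.
  by rewrite addr_ge0// subr_ge0.
have Y0 : 0 <= A * y ^+ 2 + x ^+ 2 * B.
  by rewrite addr_ge0// mulr_ge0// sqr_ge0.
apply: (le_trans (ler_norm _)).
rewrite -(@ler_pXn2r _ 2)// ?nnegrE// real_normK ?num_real//.
apply: (@le_trans _ _ (4 * (A * B) * (x * y) ^+ 2)).
  rewrite (_ : (_ * (x * y)) ^+ 2 = 4 * S ^+ 2 * (x * y) ^+ 2); last by ring.
  by rewrite ler_wpM2r ?sqr_ge0// ler_pM2l.
rewrite -subr_ge0 (_ : _ - _ = (A * y ^+ 2 - x ^+ 2 * B) ^+ 2) ?sqr_ge0//; ring.
Qed.

Lemma sqr_sum_le (m : nat) (b : 'I_m -> R) :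
  (\sum_i b i) ^+ 2 <= m%:R * \sum_i b i ^+ 2.
Proof.
have := cauchy_schwarz_seq (index_enum 'I_m) (fun=> 1) b.
under eq_bigr do rewrite mul1r.
by under [X in _ <= X * _ -> _]eq_bigr do rewrite expr1n; rewrite sumr_const card_ord.
Qed.

Lemma sqr_sum_subsingleton (m : nat) (F : pred 'I_m) (a : 'I_m -> R) :
  (forall i j, F i -> F j -> i = j) ->
  (\sum_(i | F i) a i) ^+ 2 = \sum_(i | F i) a i ^+ 2.
Proof.
move=> Fij; have [i Fi|F0] := pickP F; last by rewrite !big_pred0// expr0n.
have Fi1 : F =1 pred1 i.
  by move=> j; apply/idP/eqP => [Fj|->//]; exact: Fij.
by rewrite !(eq_bigl _ _ Fi1) !big_pred1_eq.
Qed.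

End real_inequalities.

(** * The modulus of complex numbers *)

Section normc.
Variable R : realType.
Implicit Types x y : R[i].
Local Notation normc := (@Normc.normc R).

Lemma normc_ge0 x : 0 <= normc x.
Proof. exact: (@normr_ge0 R (Rcomplex R)). Qed.

Lemma ler_normcD x y : normc (x + y) <= normc x + normc y.
Proof. exact: (@le_normcD R). Qed.

Lemma ler_normc_sum (I : Type) (r : seq I) (F : I -> R[i]) :
  normc (\sum_(i <- r) F i) <= \sum_(i <- r) normc (F i).
Proof.
elim: r => [|i r IH]; first by rewrite !big_nil Normc.normc0.
rewrite !big_cons; apply: le_trans (ler_normcD _ _) _; exact: lerD.
Qed.

(** The gap is [s^-1 * (s * a - b) ^+ 2], with [a] and [b] the two moduli. The weight [s] stays free
    so that the bound can be summed first and optimized afterwards. *)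
Lemma normcD_sqr s x y : 0 < s ->
  normc (x + y) ^+ 2 <= (1 + s) * normc x ^+ 2 + (1 + s^-1) * normc y ^+ 2.
Proof.
move=> s0; apply: (@le_trans _ _ ((normc x + normc y) ^+ 2)).
  by rewrite ler_sqr ?nnegrE ?addr_ge0 ?normc_ge0// ler_normcD.
move: (normc x) (normc y) => a b.
rewrite -subr_ge0 (_ : _ - _ = s^-1 * (s * a - b) ^+ 2).
  by rewrite mulr_ge0 ?sqr_ge0// invr_ge0 ltW.
by field; rewrite gt_eqF.
Qed.

End normc.

(** * The norm on square-summable functions and its invariance under translation *)

Section sqnorm.
Variables (R : realType) (G : groupType).
Local Notation l2 := (l2 R G).
Local Notation normc := (@Normc.normc R).
Implicit Types (v w : l2) (f : G -> R).

Lemma ge0_esumZl (c : R) f : 0 <= c -> (forall g, 0 <= f g) ->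
  (\esum_(g in [set: G]) (c * f g)%:E <= c%:E * \esum_(g in [set: G]) (f g)%:E)%E.
Proof.
move=> c0 f0; apply: ge_ereal_sup => _ [X [finX XI]] <-.
under eq_fsbigr do rewrite EFinM.
rewrite -ge0_mule_fsumr; last by move=> g; rewrite lee_fin.
by apply: lee_wpmul2l; rewrite ?lee_fin// esum_ge//; exists X.
Qed.

Lemma sqnorm_ge0 (v : G -> R[i]^o) : (0 <= sqnorm v)%E.
Proof. by apply: esum_ge0 => g _; rewrite lee_fin sqr_ge0. Qed.

Lemma l2norm_ge0 v : 0 <= l2norm v.
Proof. exact: sqrtr_ge0. Qed.
Hint Resolve l2norm_ge0 : core.

Lemma sqnormE v : sqnorm v = (l2norm v ^+ 2)%:E.
Proof.
rewrite /l2norm sqr_sqrtr ?fine_ge0 ?sqnorm_ge0// fineK//.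
rewrite ge0_fin_numE ?sqnorm_ge0//.
by case: v => v /= /asboolP.
Qed.

Lemma le_l2norm v M : 0 <= M -> (sqnorm v <= (M ^+ 2)%:E)%E -> l2norm v <= M.
Proof. by move=> M0; rewrite sqnormE lee_fin ler_sqr// nnegrE. Qed.

Lemma l2_eq v w : v =1 w -> v = w.
Proof. by move=> vw; apply/val_inj/funext. Qed.

Lemma l2D v w g : (v + w) g = v g + w g. Proof. by []. Qed.
Lemma l2N v g : (- v) g = - v g. Proof. by []. Qed.
Lemma l2Z a v g : (a *: v) g = a * v g. Proof. by []. Qed.
Lemma l20 g : (0 : l2) g = 0. Proof. by []. Qed.
Lemma l2_sum (I : Type) (r : seq I) (F : I -> l2) g :
  (\sum_(i <- r) F i) g = \sum_(i <- r) F i g.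
Proof. exact: (big_morph (fun v : l2 => v g) (fun v w => l2D v w g) (l20 g)). Qed.

Lemma ler_l2norm_sum_sqr v (r : seq G) : uniq r ->
  \sum_(g <- r) normc (v g) ^+ 2 <= l2norm v ^+ 2.
Proof.
move=> ur; rewrite -lee_fin -sqnormE -sumEFin.
apply: esum_ge; exists [set` r]; first by split=> //; exact: finite_seq.
by rewrite fsbig_seq.
Qed.

Lemma ler_l2norm_coord v g : normc (v g) <= l2norm v.
Proof.
rewrite -(@ler_pXn2r _ 2)// ?nnegrE ?normc_ge0//.
by have := @ler_l2norm_sum_sqr v [:: g] isT; rewrite big_seq1.
Qed.

Lemma ler_l2normD v w : l2norm (v + w) <= l2norm v + l2norm w.
Proof.
apply/ler_addgt0Pr => e e0.
(* Adding [e / 2] makes both numbers positive, so [b / a] is a legitimate weight in [normcD_sqr].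
   With this weight the summed bound is exactly [(a + b) ^+ 2]. *)
pose a := l2norm v + e / 2; pose b := l2norm w + e / 2.
have a0 : 0 < a by rewrite ltr_wpDl// divr_gt0.
have b0 : 0 < b by rewrite ltr_wpDl// divr_gt0.
rewrite (_ : _ + _ + e = a + b); last by rewrite /a /b; lra.
apply: le_l2norm; first by rewrite addr_ge0// ltW.
have s0 : 0 < b / a by rewrite divr_gt0.
apply: (@le_trans _ _ (\esum_(g in [set: G]) (((1 + b / a) * normc (v g) ^+ 2)%:E +
  ((1 + (b / a)^-1) * normc (w g) ^+ 2)%:E))%E).
  by apply: le_esum => g _; rewrite -EFinD lee_fin l2D normcD_sqr.
have c0 : 0 <= 1 + b / a by rewrite addr_ge0// ltW.
have d0 : 0 <= 1 + (b / a)^-1 by rewrite addr_ge0// invr_ge0 ltW.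
rewrite esumD; [|by move=> g _; rewrite lee_fin mulr_ge0 ?sqr_ge0..].
apply: (@le_trans _ _ ((1 + b / a)%:E * sqnorm v + (1 + (b / a)^-1)%:E * sqnorm w)%E).
  by apply: leeD; apply: ge0_esumZl => // g; exact: sqr_ge0.
rewrite !sqnormE -!EFinM -EFinD lee_fin.
apply: (@le_trans _ _ ((1 + b / a) * a ^+ 2 + (1 + (b / a)^-1) * b ^+ 2)).
  by apply: lerD; rewrite ler_wpM2l// ler_sqr ?nnegrE// ?(ltW a0) ?(ltW b0)// lerDl divr_ge0// ltW.
by rewrite le_eqVlt; apply/orP; left; apply/eqP; field; rewrite !gt_eqF.
Qed.

Lemma ler_l2normZ a v : l2norm (a *: v) <= normc a * l2norm v.
Proof.
apply: le_l2norm; first by rewrite mulr_ge0// normc_ge0.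
rewrite exprMn EFinM -sqnormE; apply: le_trans (ge0_esumZl _ _).
- by apply: le_esum => g _; rewrite lee_fin l2Z Normc.normcM exprMn.
- exact: sqr_ge0.
- by move=> g; exact: sqr_ge0.
Qed.

Lemma sqnorm_lreg g v : sqnorm (lreg g v) = sqnorm v.
Proof.
rewrite {2}/sqnorm (reindex_esum setT setT (fun h => g^-1 * h)%g)//.
split=> //; first by move=> x y _ _ /mulgI.
by move=> y _; exists (g * y)%g => //; rewrite mulKg.
Qed.

Lemma l2norm_lreg g v : l2norm (lreg g v) = l2norm v.
Proof. by rewrite /l2norm sqnorm_lreg. Qed.

Lemma lreg_linear g : linear (lreg g : l2 -> l2).
Proof. by move=> a v w; exact: l2_eq. Qed.

Lemma lreg_comp g h v : lreg g (lreg h v) = lreg (g * h)%g v.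
Proof. by apply: l2_eq => x /=; rewrite invgM mulgA. Qed.

Lemma lreg_id v : lreg 1%g v = v.
Proof. by apply: l2_eq => x /=; rewrite invg1 mul1g. Qed.

Lemma sqnorm_delta : sqnorm (fun g : G => (g == 1%g)%:R : R[i]^o) = 1%E.
Proof.
rewrite /sqnorm (@eq_esum _ _ _ _ (fun g => if g \in [set 1%g] then 1%:E else 0%E)).
  by rewrite -esum_mkcond esum_set1.
move=> g _; case: (eqVneq g 1%g) => [->|g1].
  by rewrite mem_set// [Normc.normc _](Normc.normc1 R) expr1n.
rewrite memNset; first by rewrite [Normc.normc _](Normc.normc0 R) expr0n.
by move=> /= /eqP; apply/negP.
Qed.

Lemma delta_subproof : (fun g : G => (g == 1%g)%:R : R[i]^o) \in @sq_summable R G.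
Proof. by apply/asboolP; rewrite sqnorm_delta ltry. Qed.

Definition delta : l2 := L2 delta_subproof.

Lemma l2norm_delta : l2norm delta = 1.
Proof. by rewrite /l2norm [sqnorm _]sqnorm_delta sqrtr1. Qed.

End sqnorm.

(** * Bounds for operators, norm approximation and the span of the translations *)

Section operator_bounds.
Variables (R : realType) (G : groupType).
Local Notation l2 := (l2 R G).
Local Notation normc := (@Normc.normc R).
Local Notation lreg := (@lreg R G).
Local Notation delta := (delta R G).
Implicit Types (v w : l2) (S T : l2 -> l2) (A : set (l2 -> l2)).

(** This replaces [opnorm] in estimates: such bounds add and scale directly, without first checking
    that a supremum is finite. *)
Definition norm_bound T (M : R) := forall v, l2norm (T v) <= M * l2norm v.

Lemma norm_bound_le T M N : M <= N -> norm_bound T M -> norm_bound T N.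
Proof.
by move=> MN TM v; apply: le_trans (TM v) _; rewrite ler_wpM2r// l2norm_ge0.
Qed.

Lemma norm_boundD S T M N :
  norm_bound S M -> norm_bound T N -> norm_bound (S + T) (M + N).
Proof.
by move=> SM TN v; apply: le_trans (ler_l2normD _ _) _; rewrite mulrDl lerD.
Qed.

Lemma norm_boundZ a T M : norm_bound T M -> norm_bound (a *: T) (normc a * M).
Proof.
move=> TM v; apply: le_trans (ler_l2normZ _ _) _.
by rewrite -mulrA ler_wpM2l// normc_ge0.
Qed.

Lemma norm_bound0 : norm_bound 0 0.
Proof.
move=> v; rewrite mul0r (_ : (0 : l2 -> l2) v = 0 *: v) ?scale0r//.
apply: le_trans (_ : normc 0 * l2norm v <= 0).
  by rewrite -[X in l2norm X](scale0r v) ler_l2normZ.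
by rewrite Normc.normc0 mul0r.
Qed.

Lemma norm_bound_sum (I : eqType) (r : seq I) (F : I -> l2 -> l2) (M : I -> R) :
  (forall i, i \in r -> norm_bound (F i) (M i)) ->
  norm_bound (\sum_(i <- r) F i) (\sum_(i <- r) M i).
Proof.
elim: r => [_|i r IH FM]; first by rewrite !big_nil; exact: norm_bound0.
rewrite !big_cons; apply: norm_boundD; first by apply: FM; rewrite mem_head.
by apply: IH => j jr; apply: FM; rewrite inE jr orbT.
Qed.

Lemma norm_bound_id : norm_bound idfun 1.
Proof. by move=> v; rewrite mul1r. Qed.

Lemma norm_bound_lreg g : norm_bound (lreg g) 1.
Proof. by move=> v; rewrite l2norm_lreg mul1r. Qed.

Lemma bounded_opB S T : bounded_op S -> bounded_op T -> bounded_op (S - T).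
Proof.
move=> [lS [M SM]] [lT [N TN]]; split.
  move=> a v w; rewrite -[LHS]/(S (a *: v + w) - T (a *: v + w)) lS lT.
  by rewrite scalerBr opprD addrACA.
exists (M + normc (-1) * N).
rewrite -scaleN1r; apply: norm_boundD => //; exact: norm_boundZ.
Qed.

Lemma normc_real (x : R) : normc (real_complex R x) = `|x|.
Proof. by rewrite /= expr0n addr0 sqrtr_sqr. Qed.

Lemma norm_bound_opnorm T : bounded_op T -> norm_bound T (opnorm T).
Proof.
move=> [lT [M TM]] v; have := l2norm_ge0 v; rewrite le_eqVlt => /orP[/eqP v0|v0].
  by apply: le_trans (TM v) _; rewrite -v0 !mulr0.
(* Rescaling by the norm brings [v] into the unit ball, over which [opnorm] takes its supremum. *)
pose c := real_complex R (l2norm v).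
have c0 : c != 0 by apply/eqP => -[] /eqP; rewrite gt_eqF.
pose w := c^-1 *: v.
have vE : v = c *: w by rewrite /w scalerA mulfV// scale1r.
have w1 : l2norm w <= 1.
  apply: le_trans (ler_l2normZ _ _) _.
  by rewrite Normc.normcV normc_real gtr0_norm// mulVf// gt_eqF.
have -> : T v = c *: T w.
  have T0 : T 0 = 0 by have := lT (-1) 0 0; rewrite scaler0 addr0 scaleN1r addNr.
  by rewrite {1}vE -[c *: w]addr0 lT T0 addr0.
apply: le_trans (ler_l2normZ _ _) _.
rewrite normc_real gtr0_norm// mulrC ler_wpM2r ?(ltW v0)//.
apply: ub_le_sup; last by exists w.
exists `|M| => _ [u u1 <-]; apply: le_trans (TM u) _.
apply: (@le_trans _ _ (`|M| * l2norm u)).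
  by rewrite ler_wpM2r ?l2norm_ge0// ler_norm.
by rewrite -[leRHS]mulr1 ler_wpM2l.
Qed.

Lemma opnorm_le T M : 0 <= M -> norm_bound T M -> opnorm T <= M.
Proof.
move=> M0 TM; apply: ge_sup.
  exists (l2norm (T 0)), 0 => //=.
  by apply: le_trans (_ : 0 <= _) => //; have := norm_bound0 0; rewrite mul0r.
by move=> _ [u u1 <-]; apply: le_trans (TM u) _; rewrite -[leRHS]mulr1 ler_wpM2l.
Qed.

Lemma op_closure_approx A T (e : R) : (A `<=` @bounded_op R G) ->
  op_closure A T -> 0 < e -> exists2 S, A S & norm_bound (T - S) e.
Proof.
move=> AB [bT AT] e0; have [S AS TS] := AT e e0; exists S => //.
apply: (norm_bound_le (ltW TS)); apply: norm_bound_opnorm.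
by apply: bounded_opB => //; exact: AB.
Qed.

Lemma approx_op_closure A T : bounded_op T ->
  (forall e : R, 0 < e -> exists2 S, A S & norm_bound (T - S) e) -> op_closure A T.
Proof.
(* Halving [e] turns the non-strict bound into the strict one in [op_closure]. *)
move=> bT AT; split=> // e e0; have e20 : 0 < e / 2 by rewrite divr_gt0.
have [S AS TS] := AT _ e20; exists S => //.
apply: le_lt_trans (opnorm_le (ltW e20) TS) _.
by rewrite ltr_pdivrMr// ltr_pMr// ltr1n.
Qed.

Lemma op_sumE (I : Type) (r : seq I) (F : I -> l2 -> l2) v :
  (\sum_(i <- r) F i) v = \sum_(i <- r) F i v.
Proof. by apply: (big_morph (fun T : l2 -> l2 => T v)). Qed.

Lemma bounded_op_lreg g : bounded_op (lreg g).
Proof.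
split; first exact: lreg_linear.
by exists 1; exact: norm_bound_lreg.
Qed.

Lemma lreg_span_bounded : @lreg_span R G `<=` @bounded_op R G.
Proof.
move=> _ [s ->]; split; last first.
  exists (\sum_(p <- s) normc p.1 * 1); apply: norm_bound_sum => p _.
  exact/norm_boundZ/norm_bound_lreg.
move=> a v w; rewrite !op_sumE scaler_sumr -big_split; apply: eq_bigr => p _ /=.
rewrite -[LHS]/(p.1 *: lreg p.2 (a *: v + w)) lreg_linear.
by rewrite scalerDr !scalerA mulrC.
Qed.

Lemma reduced_Cstar_lreg g : @reduced_Cstar R G (lreg g).
Proof.
apply: (@approx_op_closure (@lreg_span R G)); first exact: bounded_op_lreg.
move=> e e0; exists (lreg g).
  by exists [:: (1, g)]; rewrite big_seq1 scale1r.
rewrite subrr; exact: norm_bound_le (ltW e0) norm_bound0.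
Qed.

Lemma lreg1E : lreg 1%g = idfun.
Proof. by apply/funext => v; exact: lreg_id. Qed.

(** A finite combination of translations is left convolution by [S delta], so Cauchy-Schwarz bounds
    each coordinate. As [S] enters the bound only through [S delta], the estimate is usable for norm
    limits. *)
Lemma lreg_span_coord S v g : @lreg_span R G S ->
  normc (S v g) <= l2norm (S delta) * l2norm v.
Proof.
move=> [s ->]; rewrite !op_sumE l2_sum.
set u := (X in l2norm X).
(* The same group element may occur several times in [s]; over the duplicate-free [r] its
   coefficients are collected into [u h]. *)
pose r := undup [seq p.2 | p <- s].
have uE h : u h = \sum_(p <- s) p.1 * (p.2 == h)%:R.
  rewrite /u l2_sum; apply: eq_bigr => p _.
  by rewrite l2Z /= mulg_eq1 (inj_eq invg_inj).
have -> : \sum_(p <- s) (p.1 *: lreg p.2) v g = \sum_(h <- r) u h * v (h^-1 * g)%g.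
  under [RHS]eq_bigr do rewrite uE mulr_suml.
  rewrite exchange_big /=; apply: eq_big_seq => p ps.
  rewrite (bigD1_seq p.2)/= ?undup_uniq ?mem_undup ?map_f//.
  rewrite eqxx mulr1 big1 ?addr0// => h hp.
  by rewrite eq_sym (negbTE hp) mulr0 mul0r.
apply: le_trans (ler_normc_sum _ _) _.
rewrite -(@ler_pXn2r _ 2)// ?nnegrE ?mulr_ge0 ?l2norm_ge0//; last first.
  by apply: sumr_ge0 => h _; exact: normc_ge0.
under eq_bigr do rewrite Normc.normcM.
apply: le_trans (cauchy_schwarz_seq _ _ _) _.
rewrite exprMn ler_pM ?sumr_ge0// => [h _|h _||].
- exact: sqr_ge0.
- exact: sqr_ge0.
- by apply: ler_l2norm_sum_sqr; exact: undup_uniq.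
- have := @ler_l2norm_sum_sqr _ _ v [seq h^-1 * g | h <- r]%g.
  by rewrite big_map; apply; rewrite map_inj_uniq ?undup_uniq// => x y /mulIg/invg_inj.
Qed.

End operator_bounds.

(** * The ping-pong norm estimate *)

Section powers_averaging.
Variables (R : realType) (G : groupType).
Local Notation l2 := (l2 R G).
Local Notation normc := (@Normc.normc R).
Local Notation lreg := (@lreg R G).
Local Notation delta := (delta R G).
Implicit Types (v w : l2) (S T : l2 -> l2).

(** Split the i-th translate of [v] into its part on [F i] and the rest. The parts on the disjoint
    [F i] are orthogonal. The rest comes from [v] on [E i]; Cauchy-Schwarz costs a factor [m], but
    these restrictions have total square norm at most that of [v]. Each half contributes [2 * m] to
    the square of the bound. *)
Lemma norm_bound_ping_pong (m : nat) (g : 'I_m -> G) (E F : 'I_m -> set G) :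
  trivIset setT E -> trivIset setT F ->
  (forall i x, ~ E i x -> F i (g i * x)%g) ->
  norm_bound (\sum_i lreg (g i) : l2 -> l2) (2 * Num.sqrt m%:R).
Proof.
move=> tE tF gEF v; apply: le_l2norm.
  by rewrite mulr_ge0 ?mulr_ge0 ?sqrtr_ge0 ?l2norm_ge0.
pose b i x : R := normc (v ((g i)^-1 * x)%g) ^+ 2.
have b0 i x : 0 <= b i x by exact: sqr_ge0.
pose e i x : R := `[< E i ((g i)^-1 * x)%g >]%:R * b i x.
pose f i x : R := `[< F i x >]%:R * b i x.
have e0 i x : 0 <= e i x by rewrite mulr_ge0.
have f0 i x : 0 <= f i x by rewrite mulr_ge0.
have pointwise x : normc ((\sum_i lreg (g i)) v x) ^+ 2 <=
    \sum_i (2 * f i x + 2 * m%:R * e i x).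
  rewrite op_sumE l2_sum.
  (* Off [F i], the i-th term at [x] only sees the values of [v] on [E i]. *)
  pose a i := normc (v ((g i)^-1 * x)%g).
  have a0 i : 0 <= a i by exact: normc_ge0.
  pose Fx i := `[< F i x >].
  pose a' i := `[< E i ((g i)^-1 * x)%g >]%:R * a i.
  have a'0 i : 0 <= a' i by rewrite mulr_ge0.
  have aa' i : a i <= (Fx i)%:R * a i + a' i.
    rewrite /a' /Fx; case: asboolP => Fix; first by rewrite mul1r lerDl; exact: (a'0 i).
    rewrite mul0r add0r; case: asboolP => [_|Eix]; first by rewrite mul1r.
    by have := gEF _ _ Eix; rewrite mulVKg.
  have le1 : normc (\sum_i (lreg (g i) v) x) <= \sum_(i | Fx i) a i + \sum_i a' i.
    apply: le_trans (ler_normc_sum _ _) _.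
    rewrite [X in _ <= X + _]big_mkcond -big_split /=. apply: ler_sum => i _.
    apply: le_trans (aa' i) _; rewrite lerD2r.
    by case: (Fx i); rewrite ?mul1r ?mul0r.
  have A0 : 0 <= \sum_(i | Fx i) a i by apply: sumr_ge0 => *; exact: a0.
  have B0 : 0 <= \sum_i a' i by apply: sumr_ge0 => *; exact: a'0.
  (* At a given [x] at most one index satisfies [Fx], so the first square splits without loss; the
     second goes through [sqr_sum_le], which gives the factor [m]. *)
  apply: (@le_trans _ _ (2 * (\sum_(i | Fx i) a i) ^+ 2 + 2 * (\sum_i a' i) ^+ 2)).
    apply: (@le_trans _ _ ((\sum_(i | Fx i) a i + \sum_i a' i) ^+ 2)).
      by rewrite ler_sqr ?nnegrE ?addr_ge0 ?normc_ge0.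
    move: (\sum_(i | Fx i) a i) (\sum_i a' i) => A B.
    by rewrite -subr_ge0 (_ : _ - _ = (A - B) ^+ 2) ?sqr_ge0//; ring.
  rewrite big_split /= -!mulr_sumr; apply: lerD; last first.
    rewrite -mulrA ler_pM2l//; apply: le_trans (sqr_sum_le _) _.
    rewrite ler_wpM2l//; apply: ler_sum => i _.
    by rewrite /e /a'; case: asboolP; rewrite ?mul1r// !mul0r expr0n.
  rewrite ler_pM2l// sqr_sum_subsingleton.
    rewrite [leLHS]big_mkcond; apply: ler_sum => i _.
    by rewrite /f /Fx; case: asboolP; rewrite ?mul1r ?mul0r.
  move=> i j /asboolP Fi /asboolP Fj.
  by apply: (tF i j) => //; exists x.
apply: (@le_trans _ _ (\esum_(x in [set: G]) \sum_i (2 * f i x + 2 * m%:R * e i x)%:E)%E).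
  by apply: le_esum => x _; rewrite sumEFin lee_fin.
have c0 : 0 <= 2 * m%:R :> R by rewrite mulr_ge0.
rewrite esum_sum; last by move=> *; rewrite lee_fin addr_ge0 //; apply: mulr_ge0.
(* The [f] part is bounded by the whole translate; the change of variable [x -> (g i)^-1 * x] turns
   the [e] part into the mass of [v] on [E i]. *)
have sumE i : (\esum_(x in [set: G]) (2 * f i x + 2 * m%:R * e i x)%:E <=
   2%:E * sqnorm v + (2 * m%:R)%:E * \esum_(x in [set: G]) (`[< E i x >]%:R * normc (v x) ^+ 2)%:E)%E.
  under eq_esum do rewrite EFinD.
  rewrite esumD; [|by move=> *; rewrite lee_fin mulr_ge0..].
  apply: leeD.
    apply: le_trans (ge0_esumZl _ _) _ => //.
    rewrite -(sqnorm_lreg (g i) v); apply: lee_wpmul2l => //.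
    apply: le_esum => x _; rewrite lee_fin /f /b /=.
    by case: asboolP; rewrite ?mul1r ?mul0r ?sqr_ge0.
  apply: le_trans (ge0_esumZl _ _) _ => //.
  apply: lee_wpmul2l => //.
  rewrite [leRHS](reindex_esum setT setT (fun x => (g i)^-1 * x)%g)//.
  split=> //; first by move=> x y _ _ /mulgI.
  by move=> y _; exists (g i * y)%g => //; rewrite mulKg.
apply: le_trans (lee_sum _ (fun i _ => sumE i)) _.
have p0 i x : (0 <= (`[< E i x >]%:R * normc (v x) ^+ 2)%:E)%E.
  by rewrite lee_fin; apply: mulr_ge0 => //; exact: sqr_ge0.
rewrite big_split /= -[X in (_ + X <= _)%E]ge0_sume_distrr; last first.
  by move=> i _; apply: esum_ge0 => x _; exact: p0.
rewrite -esum_sum; last by move=> *; exact: p0.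
have sumE1 : (\esum_(x in [set: G]) \sum_i 
    (`[< E i x >]%:R * normc (v x) ^+ 2)%:E <= sqnorm v)%E.
  apply: le_esum => x _; rewrite sumEFin lee_fin -mulr_suml -[leRHS]mul1r.
  rewrite ler_wpM2r ?sqr_ge0//.
  have [i /asboolP Ei|E0] := pickP (fun i => `[< E i x >]); last first.
    by rewrite big1// => i _; rewrite E0.
  rewrite (bigD1 i)//= big1 ?addr0 ?lern1 ?leq_b1// => j ji.
  case: asboolP => // Ej; case/eqP: ji; apply: tE => //; by exists x.
apply: (@le_trans _ _ (\sum_(i < m) 2%:E * sqnorm v + (2 * m%:R)%:E * sqnorm v)%E).
  by rewrite leeD2l// lee_wpmul2l// lee_fin.
rewrite sqnormE -EFinM sumEFin -EFinM -EFinD lee_fin sumr_const card_ord.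
have -> : 2 * l2norm v ^+ 2 *+ m = 2 * m%:R * l2norm v ^+ 2 by rewrite -mulr_natr mulrAC.
by rewrite 2!exprMn (@sqr_sqrtr _ m%:R)// le_eqVlt; apply/orP; left; apply/eqP; ring.
Qed.
End powers_averaging.

(** * Averages of conjugates and the Powers averaging property *)

Section averaging.
Variables (R : realType) (G : groupType).
Local Notation l2 := (l2 R G).
Local Notation normc := (@Normc.normc R).
Local Notation lreg := (@lreg R G).
Local Notation delta := (delta R G).
Implicit Types (v w : l2) (S T : l2 -> l2) (s : seq G) (ss : seq (seq G)).

Lemma normcN1 : normc (-1) = 1.
Proof. by rewrite -(rmorphN1 (real_complex R)) normc_real normrN1. Qed.

(** For empty [s] this is the zero operator, not [T]; hence the conditions that [[::]] does not
    occur among the lists. *)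
Definition conj_avg s T : l2 -> l2 :=
  (size s)%:R^-1 *: \sum_(h <- s) (lreg h \o T \o lreg h^-1%g).

Definition iter_conj_avg ss T : l2 -> l2 := foldr conj_avg T ss.

Lemma normc_natr n : normc n%:R = n%:R.
Proof. by rewrite -(rmorph_nat (real_complex R)) normc_real ger0_norm. Qed.

Lemma conj_avgE s T v :
  conj_avg s T v = (size s)%:R^-1 *: \sum_(h <- s) lreg h (T (lreg h^-1%g v)).
Proof. by rewrite -[LHS]/(_ *: (\sum_(_ <- _) _) v) op_sumE. Qed.

Lemma conj_avg_linear s : linear (conj_avg s).
Proof.
move=> a S T; apply/funext => v.
rewrite -[RHS]/(a *: conj_avg s S v + conj_avg s T v) !conj_avgE.
rewrite scalerA [a * _]mulrC -scalerA -scalerDr; congr (_ *: _).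
by rewrite scaler_sumr -big_split; apply: eq_bigr => h _; exact: lreg_linear.
Qed.

Lemma conj_avg_fix s g : s != [::] -> (forall h, h \in s -> (h * g = g * h)%g) ->
  conj_avg s (lreg g) = lreg g.
Proof.
move=> s0 sg; apply/funext => v; rewrite conj_avgE (eq_big_seq (fun=> lreg g v)); last first.
  by move=> h hs; rewrite !lreg_comp sg// mulgK.
rewrite big_const_seq count_predT iter_addr addr0 -[X in _ *: X](@scaler_nat R[i]) scalerA mulVf ?scale1r//.
by rewrite pnatr_eq0 size_eq0.
Qed.

Lemma norm_bound_conj_avg s T M : 0 <= M -> norm_bound T M -> norm_bound (conj_avg s T) M.
Proof.
move=> M0 TM; have [->|s0] := eqVneq s [::].
  rewrite /conj_avg big_nil scaler0; exact: norm_bound_le M0 (@norm_bound0 _ _).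
have := @norm_bound_sum R G G s (fun h => lreg h \o T \o lreg h^-1%g) (fun=> M) _.
move=> /(_ _)/(norm_boundZ (size s)%:R^-1) B; apply: (norm_bound_le _ (B _)).
  rewrite big_const_seq count_predT iter_addr addr0 Normc.normcV normc_natr.
  by rewrite -[X in _ * X]mulr_natl mulrA mulVf ?mul1r// pnatr_eq0 size_eq0.
by move=> h _ v /=; rewrite l2norm_lreg -(l2norm_lreg h^-1%g v); exact: TM.
Qed.

Lemma iter_conj_avg_linear ss : linear (iter_conj_avg ss).
Proof.
by elim: ss => [//|s ss IH] a S T; rewrite /= IH; exact: conj_avg_linear.
Qed.

Lemma norm_bound_iter_conj_avg ss T M : 0 <= M -> norm_bound T M ->
  norm_bound (iter_conj_avg ss T) M.
Proof. by move=> M0 TM; elim: ss => //= s ss; exact: norm_bound_conj_avg. Qed.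

Lemma iter_conj_avg_id ss : [::] \notin ss -> iter_conj_avg ss idfun = idfun.
Proof.
elim: ss => //= s ss IH; rewrite inE negb_or eq_sym => /andP[s0 /IH ->].
rewrite -(lreg1E R G) conj_avg_fix// => h _; by rewrite mulg1 mul1g.
Qed.

(** One sequence [ss] has to serve all of [s] at once, because it will be applied to a finite
    combination of translations. *)
Definition powers_averaging : Prop := forall s (e : R), 0 < e -> 1%g \notin s ->
  exists2 ss, [::] \notin ss &
    forall t, t \in s -> norm_bound (iter_conj_avg ss (lreg t)) e.

(** The sets [E] and [F] may vary with [t]; only the conjugators [h] are shared between several
    [t]. *)
Definition ping_pong_conj (m : nat) (h : 'I_m -> G) (t : G) : Prop :=
  exists E F : 'I_m -> set G, [/\ trivIset setT E, trivIset setT F &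
    forall i x, ~ E i x -> F i (h i * t * (h i)^-1 * x)%g].

Lemma norm_bound_conj_avg_ping_pong (m : nat) (h : 'I_m -> G) t :
  ping_pong_conj h t ->
  norm_bound (conj_avg (codom h) (lreg t)) (m%:R^-1 * (2 * Num.sqrt m%:R)).
Proof.
move=> [E [F [tE tF EF]]]; rewrite /conj_avg size_codom card_ord big_image /=.
rewrite -(normc_natr m) -Normc.normcV; apply: norm_boundZ.
rewrite (eq_bigr (fun i => lreg (h i * t * (h i)^-1)%g)).
  rewrite normc_natr; exact: norm_bound_ping_pong tE tF EF.
by move=> i _; apply/funext => v /=; rewrite !lreg_comp.
Qed.

(** Averaging over [h] makes [t0], and every [t] in ping-pong position, small. The remaining
    elements commute with [h], are left unchanged, and are fewer than at the start, so induction
    applies; later averages are contractions and preserve what was gained. *)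
Lemma powers_averaging_of_ping_pong :
  (forall t0 s (m : nat), 1%g \notin t0 :: s -> exists h : 'I_m -> G,
    ping_pong_conj h t0 /\ forall t, t \in s ->
      (forall i, h i * t = t * h i)%g \/ ping_pong_conj h t) ->
  powers_averaging.
Proof.
(* The induction is on a bound for the size, since the list left over is a filtered one. *)
move=> pp s e e0; have [n sn] := ubnP (size s).
elim: n s sn => // n IH [|t0 s] sn s1; first by exists [::].
(* The average will have norm at most [2 / sqrt m], so [m] is taken at least [(2 / e) ^+ 2]; the
   successor keeps it positive. *)
have [m m0 me] : exists2 m, (0 < m)%N & m%:R^-1 * (2 * Num.sqrt m%:R) <= e :> R.
  have [m m0 em] : exists2 m, (0 < m)%N & (2 / e) ^+ 2 <= m%:R :> R.
    exists (Num.bound ((2 / e) ^+ 2)).+1 => //.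
    by apply/ltW/(lt_trans (archi_boundP (sqr_ge0 _))); rewrite ltr_nat.
  exists m => //; have r0 : 0 < Num.sqrt m%:R :> R by rewrite sqrtr_gt0 ltr0n.
  have rE : m%:R = Num.sqrt m%:R ^+ 2 :> R by rewrite sqr_sqrtr.
  rewrite rE ler_sqr ?nnegrE ?divr_ge0 ?(ltW e0) ?(ltW r0)// in em.
  rewrite {1}rE ler_pdivrMl ?exprn_gt0// expr2 -mulrA [leRHS]mulrC mulrAC -mulrA.
  rewrite [leLHS]mulrC ler_pM2l//.
  by move: em; rewrite ler_pdivrMr// mulrC.
have [h [pp0 pps]] := pp t0 s m s1.
have h0 : codom h != [::] by rewrite -size_eq0 size_codom card_ord -lt0n.
pose s' := [seq t <- s | `[< forall i, (h i * t = t * h i)%g >]].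
have [||ss ss0 ssE] := IH s'.
- by rewrite size_filter; apply: leq_ltn_trans (count_size _ _) _; move: sn; rewrite ltnS.
- by move: s1; rewrite inE negb_or => /andP[_]; apply: contra; rewrite mem_filter => /andP[].
(* [foldr] applies the last list first, so the average over [h] precedes those of [ss]. *)
exists (ss ++ [:: codom h]); first by rewrite mem_cat negb_or ss0 inE eq_sym.
move=> t ts; rewrite /iter_conj_avg foldr_cat /= -/(iter_conj_avg _ _).
have pp_e : ping_pong_conj h t ->
    norm_bound (iter_conj_avg ss (conj_avg (codom h) (lreg t))) e.
  move=> ppt; apply: norm_bound_iter_conj_avg (ltW e0) _.
  exact: norm_bound_le me (norm_bound_conj_avg_ping_pong ppt).
move: ts; rewrite inE => /orP[/eqP tt0|ts]; first by apply: pp_e; rewrite tt0.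
have [ht|ppt] := pps t ts; last exact: pp_e.
rewrite conj_avg_fix//; last by move=> _ /codomP[i ->].
by apply: ssE; rewrite mem_filter ts andbT; exact/asboolP.
Qed.

(** * Closed ideals of the reduced algebra and the canonical trace *)

Section ideal.
Variable I : set (l2 -> l2).
Hypothesis idI : closed_ideal (@reduced_Cstar R G) I.

Lemma ideal_conj_avg s T : I T -> I (conj_avg s T).
Proof.
case: idI => [_ I0 Ilin Imul _] IT.
rewrite /conj_avg -[X in I X]addr0; apply: (Ilin) => //.
elim: s => [|h s IH]; first by rewrite big_nil.
rewrite big_cons -[X in X + _]scale1r; apply: (Ilin) => //.
by case: (Imul _ _ (reduced_Cstar_lreg R h^-1%g) (Imul _ _ (reduced_Cstar_lreg R h) IT).1).
Qed.

Lemma ideal_iter_conj_avg ss T : I T -> I (iter_conj_avg ss T).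
Proof. by move=> IT; elim: ss => //= s ss; exact: ideal_conj_avg. Qed.

Lemma reduced_Cstar_approx T (e : R) : reduced_Cstar T -> 0 < e ->
  exists2 S, lreg_span S & norm_bound (T - S) e.
Proof. exact: (op_closure_approx (@lreg_span_bounded R G)). Qed.

(** The vector [delta] is separating: if a finite combination [S] is close to [T], then [S delta] is
    small, and [lreg_span_coord] makes every coordinate of [S v] small. *)
Lemma reduced_Cstar_delta T : reduced_Cstar T -> T delta = 0 -> T = 0.
Proof.
move=> CT Td; apply/funext => v; apply: l2_eq => g.
apply: (@Normc.eq0_normc R); apply/eqP; rewrite eq_le normc_ge0 andbT.
apply/ler_addgt0Pr => e e0; rewrite add0r.
have b0 : 0 < 2 * l2norm v + 1 by rewrite ltr_wpDl// mulr_ge0// l2norm_ge0.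
(* Two errors of size [d * l2norm v] occur; the [+ 1] keeps the denominator positive. *)
pose d := e / (2 * l2norm v + 1); have d0 : 0 < d by rewrite divr_gt0.
have [S sS TS] := reduced_Cstar_approx CT d0.
have Sd : l2norm (S delta) <= d.
  have := TS delta; rewrite l2norm_delta mulr1 -[(T - S) _]/(T delta - S delta) Td.
  have := ler_l2normZ (-1) (0 - S delta).
  by rewrite sub0r scaleN1r opprK normcN1 mul1r; exact: le_trans.
have -> : T v g = (T - S) v g + S v g.
  by rewrite -[(T - S) v]/(T v - S v) l2D l2N addrNK.
apply: le_trans (ler_normcD _ _) _; apply: (@le_trans _ _ (d * l2norm v + d * l2norm v)).
  apply: lerD; first exact: le_trans (ler_l2norm_coord _ _) (TS v).
  by apply: le_trans (lreg_span_coord _ _ sS) _; rewrite ler_wpM2r// l2norm_ge0.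
rewrite -mulrDr /d mulrAC ler_pdivrMr// ler_pM2l//; lra.
Qed.

(** The canonical trace: on a finite combination of translations it is the coefficient of the
    identity. *)
Definition trace T : R[i] := T delta 1%g.

Lemma normc_trace T M : norm_bound T M -> normc (trace T) <= M.
Proof.
move=> TM; apply: le_trans (ler_l2norm_coord _ _) _.
by apply: le_trans (TM _) _; rewrite l2norm_delta mulr1.
Qed.

Lemma lreg_span_trace S : lreg_span S -> exists2 s : seq (R[i] * G),
  1%g \notin [seq p.2 | p <- s] &
  S = trace S *: idfun + \sum_(p <- s) p.1 *: lreg p.2.
Proof.
move=> [s SE]; exists [seq p <- s | p.2 != 1%g].
  by apply/mapP => -[p]; rewrite mem_filter => /andP[/negP p1 _ /esym/eqP].
rewrite big_filter {1}SE (bigID (fun p => p.2 == 1%g))/=; congr (_ + _).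
have -> : trace S = \sum_(p <- s | p.2 == 1%g) p.1.
  rewrite /trace SE op_sumE l2_sum [RHS]big_mkcond; apply: eq_bigr => p _.
  rewrite -[LHS]/(p.1 * (p.2^-1 * 1 == 1)%g%:R) mulg1 invg_eq1.
  by case: eqP; rewrite ?mulr1 ?mulr0.
rewrite scaler_suml; apply: eq_bigr => p /eqP ->.
by rewrite lreg1E.
Qed.

(** As [delta] is separating, a nonzero [T] has a nonzero coordinate of [T delta] at some [g];
    translation by [g^-1] moves it to the identity, and scaling normalizes it. *)
Lemma ideal_trace1 : I <> [set 0] -> exists2 T, I T & trace T = 1.
Proof.
case: (idI) => [IC I0 Ilin Imul _] In0.
have [T IT T0] : exists2 T, I T & T <> 0.
  apply: contra_notP In0 => nT; apply/seteqP; split=> T /=; last by move=> ->.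
  by move=> IT; apply: contra_notP nT => T0; exists T.
have [g Tg] : exists g, T delta g != 0.
  apply: contra_notP T0 => nT; apply: reduced_Cstar_delta; first exact: IC.
  apply: l2_eq => g; rewrite l20; apply/eqP.
  by apply: contra_notT nT => Tg; exists g.
exists ((T delta g)^-1 *: (lreg g^-1%g \o T) + 0).
  by apply: Ilin => //; case: (Imul _ _ (reduced_Cstar_lreg R g^-1%g) IT).
rewrite addr0 /trace -[LHS]/(_^-1 * T delta (g^-1^-1 * 1)%g).
by rewrite invgK mulg1 mulVf.
Qed.

Lemma powers_averaging_ideal_id : powers_averaging -> I <> [set 0] -> I idfun.
Proof.
move=> pa /ideal_trace1[T IT T1]; case: (idI) => [IC _ _ _]; apply.
apply: approx_op_closure.
  by rewrite -(lreg1E R G); exact: bounded_op_lreg.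
(* Three errors of size [d] add up: replacing [T] by [S], replacing [trace S] by 1, and the averaged
   nontrivial terms of [S]. *)
move=> e e0; pose d := e / 3; have d0 : 0 < d by rewrite divr_gt0.
have [S sS TS] := reduced_Cstar_approx (IC _ IT) d0.
have [s s1 SE] := lreg_span_trace sS.
(* Averaging each translation down to [d / c] brings their combination, with these coefficients,
   down to [d]. *)
pose c := 1 + \sum_(p <- s) normc p.1.
have c0 : 0 < c by rewrite ltr_wpDr// sumr_ge0// => p _; exact: normc_ge0.
have [ss ss0 ssE] := pa _ _ (divr_gt0 d0 c0) s1.
pose phi := iter_conj_avg ss.
have phiL : linear phi := iter_conj_avg_linear ss.
exists (phi T); first exact: ideal_iter_conj_avg.
pose N := \sum_(p <- s) p.1 *: lreg p.2.
have phiD A B : phi (A + B) = phi A + phi B.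
  by have := phiL 1 A B; rewrite !scale1r.
have phi0 : phi 0 = 0 by apply: (@addrI _ (phi 0)); rewrite -phiD !addr0.
have phiZ a A : phi (a *: A) = a *: phi A.
  by have := phiL a A 0; rewrite !addr0 phi0 addr0.
have NE : norm_bound (phi N) d.
  have phiN : phi N = \sum_(p <- s) p.1 *: phi (lreg p.2).
    rewrite /N; elim: (s) => [|p r IH]; first by rewrite !big_nil.
    by rewrite !big_cons phiD phiZ IH.
  rewrite phiN; apply: (@norm_bound_le _ _ _ (\sum_(p <- s) normc p.1 * (d / c))).
    rewrite -mulr_suml mulrCA ger_pMr// ler_pdivrMr// mul1r /c.
    by rewrite lerDr.
  apply: norm_bound_sum => p ps; apply/norm_boundZ/ssE/map_f/ps.
have tS : normc (1 - trace S) <= d.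
  by rewrite -T1; exact: (normc_trace TS).
have -> : idfun - phi T =
    -1 *: phi (T - S) + ((1 - trace S) *: idfun + -1 *: phi N).
  have -> : phi T = phi (T - S) + (trace S *: idfun + phi N).
    by rewrite -{1}(iter_conj_avg_id ss0) -phiZ -!phiD -SE subrK.
  rewrite !scaleN1r scalerBl scale1r !opprD !addrA; congr (_ - _ - _); exact: addrC.
have -> : e = normc (-1) * d + (d * 1 + normc (-1) * d).
  by rewrite normcN1 !mul1r mulr1 /d; field.
apply: norm_boundD.
  by apply/norm_boundZ/norm_bound_iter_conj_avg => //; exact: ltW.
apply: norm_boundD; last exact: norm_boundZ.
apply: norm_bound_le (norm_boundZ _ (@norm_bound_id _ _)).
by rewrite mulr1 mulr1.
Qed.

End ideal.

Lemma powers_averaging_Cstar_simple : powers_averaging -> Cstar_simple R G.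
Proof.
move=> pa; split.
  move=> /seteqP[/(_ _ (reduced_Cstar_lreg R 1%g)) /= /(congr1 (fun T => T delta 1%g))].
  rewrite lreg1E /= eqxx => /eqP; rewrite -[X in _ == X]/(0 : R[i]).
  by rewrite oner_eq0.
move=> I idI; have [->|In0] := pselect (I = [set 0]); [by left | right].
have I1 := powers_averaging_ideal_id idI pa In0.
case: idI => [IC _ _ Imul _]; apply/seteqP; split=> // T CT.
by case: (Imul T idfun CT I1).
Qed.

End averaging.

(** * Clopen sets fixed or displaced by homeomorphisms, and disjoint clopen families *)

Section clopen_sets.
Variable T : topologicalType.
Hypothesis T0 : zero_dimensional T.
Implicit Types (U V : set T) (f : homeo T).

Lemma homeo_displace f U x : clopen U -> U x -> f x <> x ->
  exists V, [/\ clopen V, V x, V `<=` U & forall y, V y -> ~ V (f y)].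
Proof.
move=> cU Ux /eqP; rewrite eq_sym => /T0[W [cW Wx nWfx]].
(* The clopen [W] separates [x] from [f x]; the points of [W] that [f] sends out of [W] form a
   displaced set. *)
exists (U `&` W `&` f @^-1` (~` W)); split=> //; last first.
- by move=> y [_ nWfy] [[_ /nWfy]].
- by move=> y [[]].
apply: clopenI; first exact: clopenI.
by apply: clopen_comp; [exact: clopenC | exact: (homeoP f).1].
Qed.

Definition fixes_or_displaces V f :=
  (forall x, V x -> f x = x) \/ (forall x, V x -> ~ V (f x)).

Lemma fixes_or_displaces_sub U V f : V `<=` U ->
  fixes_or_displaces U f -> fixes_or_displaces V f.
Proof.
move=> VU [fU|fU]; [left|right] => x /VU Ux; first exact: fU.
by move=> /VU; exact: fU.
Qed.

(** A homeomorphism that is not the identity on the current set moves a point of it, hence displaces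
    a clopen neighbourhood of that point. Both alternatives pass to subsets, so shrinking for later
    elements does no harm. *)
Lemma clopen_fixes_or_displaces (s : seq (homeo T)) U : clopen U -> U !=set0 ->
  exists V, [/\ clopen V, V !=set0, V `<=` U &
    forall f, f \in s -> fixes_or_displaces V f].
Proof.
elim: s U => [|f s IH] U cU U0; first by exists U; split=> // f.
have [W [cW W0 WU fW]] : exists W, [/\ clopen W, W !=set0, W `<=` U &
    fixes_or_displaces W f].
  have [fU|] := pselect (forall x, U x -> f x = x).
    by exists U; split=> //; left.
  move=> /existsNP[x] /not_implyP[Ux fx].
  have [V [cV Vx VU fV]] := homeo_displace cU Ux fx.
  by exists V; split=> //; [exists x | right].
have [V [cV V0 VW sV]] := IH W cW W0; exists V; split=> //.
  exact: subset_trans VW WU.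
move=> g; rewrite inE => /orP[/eqP ->|]; last exact: sV.
exact: fixes_or_displaces_sub VW fW.
Qed.

(** Perfectness gives two points in [U]; a clopen [W] separating them yields the first set [U & W],
    and the others are found in the nonempty rest. Only the values of [B] below [m] carry
    information. *)
Lemma disjoint_clopens U m : perfect_set [set: T] -> clopen U -> U !=set0 ->
  exists B : nat -> set T, (forall i, (i < m)%N -> [/\ clopen (B i), B i !=set0 & B i `<=` U]) /\
    forall i j, (i < j < m)%N -> B i `&` B j = set0.
Proof.
move=> /perfectTP_ex pT; elim: m U => [|m IH] U cU U0.
  by exists (fun=> U); split=> // i j; rewrite ltn0 andbF.
have [x [y [Ux Uy /T0[W [cW Wx nWy]]]]] := pT U cU.1 U0.
have cUW : clopen (U `\` W) by rewrite setDE; exact/clopenI/clopenC.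
have [B [BU Bdisj]] := IH _ cUW (ex_intro _ y (conj Uy nWy)).
exists (fun i => if i is j.+1 then B j else U `&` W); split.
  case=> [|i] im; last by have [? ? /subset_trans BiU] := BU i im; split=> //; apply: BiU => z [].
  by split; [exact: clopenI | exists x | move=> z []].
case=> [|i] [|j] //= ijm; last exact: Bdisj.
have [_ _ BjU] := BU j ijm.
by apply/seteqP; split=> // z [[_ Wz] /BjU[]].
Qed.

End clopen_sets.

(** * The action of a group of homeomorphisms and ping-pong inside the group *)

Section homeo_action.
Variables (T : topologicalType) (H : groupClosed (homeo T)).
Local Notation G := (subgroup H).
Implicit Types (g h t l : G) (V : set T).

Definition act g : T -> T := homeo_fun (subgroup_val g).

Lemma actM g h x : act (g * h)%g x = act g (act h x).
Proof. by []. Qed.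

Lemma act1 x : act 1%g x = x.
Proof. by []. Qed.

Lemma actK g : cancel (act g) (act g^-1%g).
Proof. by move=> x; rewrite -actM mulVg. Qed.

Lemma actVK g : cancel (act g^-1%g) (act g).
Proof. by move=> x; rewrite -actM mulgV. Qed.

Lemma act_eq g h : act g =1 act h -> g = h.
Proof. by move=> gh; apply/val_inj/homeo_ext. Qed.

(** The equivalence says that [g] maps [V] onto itself, so the condition passes to inverses. *)
Definition stabilizes V g := forall x, V x <-> V (act g x).

Lemma stabilizesM V g h : stabilizes V g -> stabilizes V h -> stabilizes V (g * h)%g.
Proof. by move=> gV hV x; rewrite actM -gV -hV. Qed.

Lemma stabilizesV V g : stabilizes V g -> stabilizes V g^-1%g.
Proof. by move=> gV x; rewrite (gV (act g^-1%g x)) actVK. Qed.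

Lemma stabilizes_supp V g : (forall x, ~ V x -> act g x = x) -> stabilizes V g.
Proof.
move=> gV x; split=> [Vx|Vgx]; apply: contrapT => nV; have := gV _ nV.
  by move=> /(can_inj (actK g)) gx; apply: nV; rewrite gx.
by move=> gx; apply: nV; rewrite -gx.
Qed.

Lemma stabilizes_fix V g : (forall x, V x -> act g x = x) -> stabilizes V g.
Proof.
move=> gV x; split=> [Vx|Vgx]; first by rewrite gV.
by have /(can_inj (actK g)) <- := gV _ Vgx.
Qed.

(* [psi] writes [g] as [l * c], with [c] the chosen representative of its coset
   under the stabilizer of [V], and moves a base point of [V] by [l]. *)
Lemma equivariant_map V : V !=set0 -> exists psi : G -> T,
  (forall g, V (psi g)) /\
  forall l g, stabilizes V l -> psi (l * g)%g = act l (psi g).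
Proof.
move=> [z Vz].
pose coset g := [set c | stabilizes V (g * c^-1)%g].
pose rep g := xget 1%g (coset g).
have repP g : stabilizes V (g * (rep g)^-1)%g.
  by apply: (@xgetPex _ 1%g (coset g)); exists g; rewrite /coset /= mulgV => x; rewrite act1.
have repM l g : stabilizes V l -> rep (l * g)%g = rep g.
  move=> lV; congr xget; apply/seteqP; split=> c; rewrite /coset /= -mulgA.
    by move=> /(stabilizesM (stabilizesV lV)); rewrite mulKg.
  exact: stabilizesM.
exists (fun g => act (g * (rep g)^-1)%g z); split=> [g|l g lV].
  by rewrite -(repP g z).
by rewrite repM// -mulgA actM.
Qed.

(** The map [psi] carries the dynamics on [V] back to the group, where [E] and [F] must live. Since
    [h i] and [k] stabilize [V], [psi] sends the conjugate applied to [x] to [h i] applied to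
    [psi (t * x)], a point of [V]. *)
Lemma ping_pong_of_displacement V (m : nat) (B : 'I_m -> set T) (h : 'I_m -> G) t :
  V !=set0 -> trivIset setT B ->
  (forall i x, ~ V x -> act (h i) x = x) ->
  (forall i x, V x -> ~ B i x -> B i (act (h i) x)) ->
  (forall x, V x -> ~ V (act t x)) -> ping_pong_conj h t.
Proof.
move=> V0 tB hV hB tV; have [psi [psiV psiM]] := equivariant_map V0.
exists (fun i => [set x | B i (psi (t * x)%g)]), (fun i => [set x | B i (psi x)]).
split=> [i j _ _ [x [Bi Bj]]|i j _ _ [x [Bi Bj]]|i x /= nBi].
- by apply: tB => //; exists (psi (t * x)%g).
- by apply: tB => //; exists (psi x).
pose k := (t * (h i)^-1 * t^-1)%g.
(* As [t] displaces [V], the point [t^-1 y] lies outside [V], where [h i] and its inverse act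
   trivially. *)
have kV y : V y -> act k y = y.
  move=> Vy; have nV : ~ V (act t^-1%g y) by move/tV; rewrite actVK.
  by rewrite 2!actM -{1}(hV i _ nV) actK actVK.
have -> : (h i * t * (h i)^-1 * x = (h i * k) * (t * x))%g.
  by rewrite /k !mulgA mulgVK.
rewrite psiM; last exact: stabilizesM (stabilizes_supp (hV i)) (stabilizes_fix kV).
rewrite actM kV//; exact: hB.
Qed.

Lemma commute_of_fix V h t : (forall x, ~ V x -> act h x = x) ->
  (forall x, V x -> act t x = x) -> (h * t = t * h)%g.
Proof.
move=> hV tV; apply: act_eq => x; rewrite !actM.
have [Vx|nVx] := pselect (V x).
  by rewrite tV// tV//; exact/(stabilizes_supp hV x).
by rewrite (hV x)// hV// -(stabilizes_fix tV).
Qed.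

End homeo_action.

(** * From vigour to Powers averaging and C*-simplicity *)

Lemma powers_averaging_vigorous (R : realType) (T : topologicalType)
    (A H : groupClosed (homeo T)) :
  compact [set: T] -> zero_dimensional T -> perfect_set [set: T] ->
  vigorous A -> {subset A <= H} -> powers_averaging R (subgroup H).
Proof.
move=> cT T0 pT vA AH; apply: powers_averaging_of_ping_pong => t0 s m.
rewrite inE negb_or => /andP[t01 _].
have [x t0x] : exists x, act t0 x <> x.
  apply/existsNP; apply: contra_neq_not t01 => t0x.
  by apply/esym/act_eq => x; rewrite t0x.
(* [t0] displaces [U], hence also the smaller [V], on which each element of [s] is then either
   trivial or displacing. *)
have [U [cU Ux _ t0U]] := homeo_displace T0 clopenT (I : [set: T] x) t0x.
have [V [cV V0 VU sV]] :=
  clopen_fixes_or_displaces T0 [seq subgroup_val t | t <- s] cU (ex_intro _ x Ux).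
have [B [BV Bdisj]] := disjoint_clopens T0 m pT cV V0.
have compactW (W : set T) : clopen W -> compact W.
  by move=> [_ cW]; exact: (subclosed_compact cW cT).
have /choice[h hP] : forall i : 'I_m, exists h : subgroup H,
    (forall y, ~ V y -> act h y = y) /\ forall y, V y -> ~ B i y -> B i (act h y).
  move=> i; have [cB B0 BiV] := BV i (ltn_ord i).
  have cVB : clopen (V `\` B i) by rewrite setDE; exact/clopenI/clopenC.
  (* Vigour requires [V] minus [B i] to be a proper subset of [V] and the target to be nonempty;
     both follow from [B i] being nonempty and inside [V]. *)
  have [||||||||||g [gA gV gB]] := vA V (V `\` B i) (B i).
  - exact: compactW.
  - exact: cV.1.
  - exact: compactW.
  - exact: cVB.1.
  - exact: compactW.
  - exact: cB.1.
  - by move=> y [].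
  - exact: BiV.
  - by move=> VB; case: B0 => y By; move: (BiV _ By); rewrite -VB => -[_]; exact.
  - by move=> B00; move: B0; rewrite B00 => -[].
  exists (Subgroup (AH _ gA)); split=> // y Vy nBy.
  by apply: gB; exists y.
have tB : trivIset setT (fun i : 'I_m => B i).
  move=> i j _ _ [y [Bi Bj]]; apply/val_inj => /=.
  case: (ltngtP i j) => // ij; exfalso.
    by have : (B i `&` B j) y by []; rewrite Bdisj ?ij ?ltn_ord.
  by have : (B j `&` B i) y by []; rewrite Bdisj ?ij ?ltn_ord.
have pp t : (forall y, V y -> ~ V (act t y)) -> ping_pong_conj h t.
  by apply: ping_pong_of_displacement tB _ _ => // i; [exact: (hP i).1 | exact: (hP i).2].
exists h; split; first by apply: pp => y /VU Uy /VU; exact: t0U.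
move=> t ts; have [tV|tV] := sV _ (map_f _ ts); last by right; exact: pp.
by left=> i; apply: commute_of_fix tV; exact: (hP i).1.
Qed.

Theorem corollary3p32 (R : realType) (A F H : groupClosed (homeo cantor_space))
    (AF : {subset A <= F})
    (A_vigorous : vigorous A)
    (A_simple : simple_group (subgroup A))
    (F_locally_closed : locally_closed F)
    (AH : {subset A <= H}) (HF : {subset H <= F}) :
  Cstar_simple R (subgroup H).
Proof.
apply: powers_averaging_Cstar_simple.
exact: powers_averaging_vigorous cantor_space_compact cantor_zero_dimensional
  cantor_perfect A_vigorous AH.
Qed.
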